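(* Let $(R,\mathfrak{m})$ be a complete Noetherian local commutative ring of prime characteristic $p$ that is $F$-finite. Let $M$ be an $x$-divisible right $R[x,f]$-module that is Noetherian as an $R$-module. Then there are only finitely many graded annihilators of $R[x,f]$-homomorphic images of $M$; that is, the set $\{\operatorname{gr-ann}(M/L)_{R[x,f]} : L \text{ is an } R[x,f]\text{-submodule of } M\}$ is finite.
   Context: $f : R \to R$, $f(r)=r^p$, is the Frobenius homomorphism; $R$ is $F$-finite if $f$ is a finite ring homomorphism. The Frobenius skew polynomial ring $R[x,f]$ is freely generated as a left $R$-module by $(x^i)_{i\ge 0}$, with multiplication subject to $xr = r^p x$ for $r\in R$; it is graded with degree-$n$ component $Rx^n$. A right $R[x,f]$-module is regarded as an $R$-module by restriction of scalars. A right $R[x,f]$-module $M$ is $x$-divisible if $M = Mx$, where $Mx = \{mx : m\in M\}$. The graded annihilator $\operatorname{gr-ann} N_{R[x,f]}$ of a right $R[x,f]$-module $N$ is the largest graded two-sided ideal of $R[x,f]$ that annihilates $N$; explicitly, it is the set of all $\sum_{i=0}^n r_i x^i \in R[x,f]$ such that each $r_ix^i$ annihilates $N$ (i.e. $g r_i x^i=0$ for all $g\in N$). *)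

(* Defs.v *)
From HB Require Import structures.
From mathcomp Require Import all_boot all_algebra.
From mathcomp Require Import ring_quotient generic_quotient.
From mathcomp Require Import mathcomp_extra boolp classical_sets functions.
From mathcomp Require Import cardinality.

Set Implicit Arguments.
Unset Strict Implicit.
Unset Printing Implicit Defensive.

Import GRing.Theory.

Local Open Scope ring_scope.
Local Open Scope quotient_scope.

(* The library's [submodClosed V] is the type of submodules of V: they are boolean
   predicates, but with the classical axioms of [boolp] every subset is one.  It
   does not record closure under opposite, which [Quotient.quot] asks for. *)
Section QuotientModule.
Variables (A : pzRingType) (V : lmodType A) (L : submodClosed V).

Definition submod_pred : {pred V} := L.

Lemma submod_pred_zmod_closed : zmod_closed submod_pred.
Proof.
case: (submodClosedP L) => L0 LB; split=> // u v uL vL.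
by rewrite addrC -scaleN1r; apply: LB.
Qed.

HB.instance Definition _ :=
  GRing.isZmodClosed.Build V submod_pred submod_pred_zmod_closed.

Definition quotient_module : Type := Quotient.quot submod_pred.

HB.instance Definition _ := GRing.Zmodule.on quotient_module.

Definition quotient_proj (v : V) : quotient_module :=
  \pi_(Quotient.quot submod_pred) v.

Definition quotient_repr (u : quotient_module) : V :=
  repr (u : Quotient.quot submod_pred).

Lemma quotient_reprK : cancel quotient_repr quotient_proj.
Proof. exact: reprK. Qed.

Lemma quotient_proj_eq (u v : V) :
  (quotient_proj u == quotient_proj v) = (u - v \in L).
Proof. by rewrite -[RHS]/(u - v \in submod_pred) Quotient.idealrBE. Qed.

Lemma quotient_projD : {morph quotient_proj : u v / u + v}.
Proof. exact: Quotient.pi_add. Qed.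

Definition quotient_scale (a : A) (u : quotient_module) : quotient_module :=
  quotient_proj (a *: quotient_repr u).

Lemma quotient_projZ (a : A) (v : V) :
  quotient_proj (a *: v) = quotient_scale a (quotient_proj v).
Proof.
apply/eqP; rewrite quotient_proj_eq -scalerBr rpredZ //.
by rewrite -quotient_proj_eq quotient_reprK.
Qed.

Lemma quotient_scaleA a b u :
  quotient_scale a (quotient_scale b u) = quotient_scale (a * b) u.
Proof. by rewrite -[u]quotient_reprK -!quotient_projZ scalerA. Qed.

Lemma quotient_scale1 : left_id 1 quotient_scale.
Proof. by move=> u; rewrite -[u]quotient_reprK -quotient_projZ scale1r. Qed.

Lemma quotient_scaleDr : right_distributive quotient_scale +%R.
Proof.
move=> a u v; rewrite -[u]quotient_reprK -[v]quotient_reprK -quotient_projD.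
by rewrite -!quotient_projZ scalerDr quotient_projD.
Qed.

Lemma quotient_scaleDl u : {morph quotient_scale^~ u : a b / a + b}.
Proof.
move=> a b /=; rewrite -[u]quotient_reprK -!quotient_projZ.
by rewrite scalerDl quotient_projD.
Qed.

HB.instance Definition _ := GRing.Zmodule_isLmodule.Build A quotient_module
  quotient_scaleA quotient_scale1 quotient_scaleDr quotient_scaleDl.

Lemma quotient_proj_linear : linear quotient_proj.
Proof. by move=> a u v; rewrite quotient_projD quotient_projZ. Qed.

HB.instance Definition _ :=
  GRing.isLinear.Build A V quotient_module _ quotient_proj quotient_proj_linear.

Lemma quotient_proj_eq0 (v : V) : (quotient_proj v == 0) = (v \in L).
Proof. by rewrite -[0](linear0 quotient_proj) quotient_proj_eq subr0. Qed.

End QuotientModule.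

Definition noetherian (A : pzRingType) (V : lmodType A) : Prop :=
  forall L : nat -> submodClosed V,
    (forall n, {subset L n <= L n.+1}) ->
    exists n, forall k, (n <= k)%N -> {subset L k <= L n}.

Section Local.
Variable R : comNzRingType.

(* The ideals in [idealr R] are proper. *)
Definition maximal_ideal (m : idealr R) : Prop :=
  forall J : idealr R, {subset m <= J} -> {subset J <= m}.

Definition local_with (m : idealr R) : Prop :=
  maximal_ideal m /\ forall n : idealr R, maximal_ideal n -> n =i m.

(* x lies in m^n: the coefficient [c] makes m^0 the unit ideal. *)
Definition ideal_pow (m : idealr R) (n : nat) (x : R) : Prop :=
  exists (k : nat) (c : 'I_k -> R) (a : 'I_k -> 'I_n -> R),
    (forall i j, a i j \in m) /\ x = \sum_(i < k) c i * \prod_(j < n) a i j.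

(* Bijectivity of R -> lim R/m^n: separation is its injectivity, convergence of
   Cauchy sequences its surjectivity. *)
Definition adic_complete (m : idealr R) : Prop :=
  (forall x, (forall n, ideal_pow m n x) -> x = 0) /\
  (forall u : nat -> R,
    (forall n, exists N, forall i j, (N <= i)%N -> (N <= j)%N ->
       ideal_pow m n (u i - u j)) ->
    exists l, forall n, exists N, forall i, (N <= i)%N ->
       ideal_pow m n (u i - l)).

End Local.

Definition finite_rmorphism (A B : comNzRingType) (f : {rmorphism A -> B})
  : Prop :=
  exists s : seq B, forall b, exists c : nat -> A,
    b = \sum_(i < size s) f (c i) * s`_i.

Definition F_finite (R : comNzRingType) (p : nat) (pR : p \in [pchar R])
  : Prop :=
  finite_rmorphism (pFrobenius_aut pR).

(* R[x,f] has the additive group of {poly R}, with the coefficients on the left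
   of the powers of x; the product is given by
   (a x^i)(b x^j) = a f^i(b) x^(i+j). *)
Definition skew_poly (R : nzRingType) (f : {rmorphism R -> R}) := {poly R}.

Section SkewPoly.
Variables (R : nzRingType) (f : {rmorphism R -> R}).
Local Notation S := (skew_poly f).
Implicit Types (p q r s : {poly R}).

HB.instance Definition _ := GRing.Zmodule.on S.

Definition skew_mul p q : {poly R} :=
  \poly_(i < (size p + size q).-1)
    (\sum_(j < i.+1) p`_j * iter j f q`_(i - j)).

Lemma iter_rmorph0 n : iter n f 0 = 0.
Proof. by elim: n => //= n ->; rewrite rmorph0. Qed.

Lemma iter_rmorph1 n : iter n f 1 = 1.
Proof. by elim: n => //= n ->; rewrite rmorph1. Qed.

Lemma iter_rmorphD n : {morph iter n f : a b / a + b}.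
Proof. by elim: n => //= n IHn a b /=; rewrite IHn rmorphD. Qed.

Lemma iter_rmorphM n : {morph iter n f : a b / a * b}.
Proof. by elim: n => //= n IHn a b /=; rewrite IHn rmorphM. Qed.

Lemma coef_skew_mul p q i :
  (skew_mul p q)`_i = \sum_(j < i.+1) p`_j * iter j f q`_(i - j).
Proof.
rewrite coef_poly ltn_predRL; case: leqP => // le_pq_i1.
rewrite big1 // => j _; have [lq_p_j|lt_j_p] := leqP (size p) j.
  by rewrite nth_default ?mul0r.
rewrite [q`__]nth_default ?iter_rmorph0 ?mulr0 // leq_subRL -ltnS //.
by rewrite (leq_trans _ le_pq_i1) // ltn_add2r.
Qed.

Lemma coef_skew_mul_rev p q i :
  (skew_mul p q)`_i = \sum_(j < i.+1) p`_(i - j) * iter (i - j) f q`_j.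
Proof.
rewrite coef_skew_mul (reindex_inj rev_ord_inj) /=.
by apply: eq_bigr => j _; rewrite subSS (sub_ordK j).
Qed.

Lemma skew_mulA : associative skew_mul.
Proof.
move=> p q r; apply/polyP=> i; rewrite coef_skew_mul coef_skew_mul_rev.
pose coef3 j k := p`_j * (iter j f q`_(i - j - k) * iter (i - k) f r`_k).
transitivity (\sum_(j < i.+1) \sum_(k < i.+1 | (k <= i - j)%N) coef3 j k).
  apply: eq_bigr => /= j _; rewrite coef_skew_mul_rev.
  rewrite (big_morph _ (iter_rmorphD j) (iter_rmorph0 j)) big_distrr /=.
  rewrite (big_ord_narrow_leq (leq_subr _ _)); apply: eq_bigr => k _ /=.
  have jk : (j + (i - j - k) = i - k)%N.
    have kij : (k <= i - j)%N by rewrite -ltnS.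
    rewrite subnAC subnKC // leq_subRL; last exact: leq_trans kij (leq_subr _ _).
    by rewrite addnC -leq_subRL // -ltnS.
  by rewrite /coef3 iter_rmorphM -jk iterD.
rewrite (exchange_big_dep predT) //=; apply: eq_bigr => k _.
transitivity (\sum_(j < i.+1 | (j <= i - k)%N) coef3 j k).
  apply: eq_bigl => j; rewrite -ltnS -(ltnS j) -!subSn ?leq_ord //.
  by rewrite -subn_gt0 -(subn_gt0 j) -!subnDA addnC.
rewrite (big_ord_narrow_leq (leq_subr _ _)) coef_skew_mul big_distrl /=.
by apply: eq_bigr => j _; rewrite /coef3 -!subnDA addnC mulrA.
Qed.

Lemma skew_mul1l : left_id 1%:P skew_mul.
Proof.
move=> p; apply/polyP => i; rewrite coef_skew_mul big_ord_recl subn0.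
by rewrite big1 => [|j _]; rewrite coefC /= ?mul0r // mul1r addr0.
Qed.

Lemma skew_mul1r : right_id 1%:P skew_mul.
Proof.
move=> p; apply/polyP => i; rewrite coef_skew_mul_rev big_ord_recl subn0.
rewrite big1 => [|j _]; rewrite coefC /= ?iter_rmorph0 ?mulr0 //.
by rewrite iter_rmorph1 mulr1 addr0.
Qed.

Lemma skew_mulDl : left_distributive skew_mul +%R.
Proof.
move=> p q r; apply/polyP=> i; rewrite coefD !coef_skew_mul -big_split.
by apply: eq_bigr => j _; rewrite coefD mulrDl.
Qed.

Lemma skew_mulDr : right_distributive skew_mul +%R.
Proof.
move=> p q r; apply/polyP=> i; rewrite coefD !coef_skew_mul -big_split.
by apply: eq_bigr => j _; rewrite coefD iter_rmorphD mulrDr.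
Qed.

Lemma skew1_neq0 : 1%:P != 0 :> {poly R}.
Proof. by rewrite polyC_eq0 oner_neq0. Qed.

HB.instance Definition _ := GRing.Zmodule_isNzRing.Build S
  skew_mulA skew_mul1l skew_mul1r skew_mulDl skew_mulDr skew1_neq0.

Definition skewC (a : R) : S := a%:P.
Definition skewX : S := 'X.
Definition skew_coef (s : S) (i : nat) : R := (s : {poly R})`_i.

Lemma skew_coefM (s t : S) i :
  skew_coef (s * t) i =
  \sum_(j < i.+1) skew_coef s j * iter j f (skew_coef t (i - j)).
Proof. exact: coef_skew_mul. Qed.

Lemma skew_coefD (s t : S) i :
  skew_coef (s + t) i = skew_coef s i + skew_coef t i.
Proof. exact: coefD. Qed.

Lemma skew_coef_inj (s t : S) : skew_coef s =1 skew_coef t -> s = t.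
Proof. by move=> st; apply/polyP. Qed.

Lemma skewCD a b : skewC (a + b) = skewC a + skewC b.
Proof. exact: polyCD. Qed.

Lemma skew_coefCM a (s : S) i : skew_coef (skewC a * s) i = a * skew_coef s i.
Proof.
rewrite skew_coefM big_ord_recl subn0 big1 => [|j _].
  by rewrite /skew_coef coefC /= addr0.
by rewrite /skew_coef coefC mul0r.
Qed.

Lemma skewCM a b : skewC (a * b) = skewC a * skewC b.
Proof.
apply: skew_coef_inj => i; rewrite skew_coefCM /skew_coef !coefC.
by case: eqP => _; rewrite ?mulr0.
Qed.

Lemma skewC1 : skewC 1 = 1.
Proof. by []. Qed.

Lemma skewXE (s : S) : skewX * s = (map_poly f s * 'X : {poly R}).
Proof.
apply: skew_coef_inj => i; rewrite skew_coefM /skew_coef coefMX.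
case: i => [|i] /=; first by rewrite big_ord1 coefX mul0r.
rewrite coef_map big_ord_recl coefX mul0r add0r big_ord_recl coefX /= mul1r.
by rewrite subSS subn0 big1 ?addr0 // => j _; rewrite coefX mul0r.
Qed.

Lemma skewXC a : skewX * skewC a = skewC (f a) * skewX.
Proof.
apply: skew_coef_inj => i; rewrite skew_coefCM skewXE /skew_coef map_polyC.
by rewrite coefCM.
Qed.

Lemma skewXnC n a : skewX ^+ n * skewC a = skewC (iter n f a) * skewX ^+ n.
Proof.
elim: n a => [|n IHn] a; first by rewrite mul1r mulr1.
by rewrite exprSr -mulrA skewXC mulrA IHn -iterSr mulrA.
Qed.

Lemma skew_monoM a i b j :
  (skewC a * skewX ^+ i) * (skewC b * skewX ^+ j) =
  skewC (a * iter i f b) * skewX ^+ (i + j).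
Proof.
by rewrite mulrA -[_ * _ * skewC b]mulrA skewXnC skewCM exprD !mulrA.
Qed.

Lemma skewXnE n : skewX ^+ n = ('X^n : {poly R}).
Proof.
elim: n => // n IHn.
by rewrite exprS IHn skewXE map_polyXn -exprSr.
Qed.

Lemma skew_polyE (s : S) :
  s = \sum_(i < size (s : {poly R})) skewC (skew_coef s i) * skewX ^+ i.
Proof.
apply: skew_coef_inj => i.
rewrite (big_morph (skew_coef^~ i) (fun s t => skew_coefD s t i) (coef0 _ i)).
rewrite -[LHS]/((s : {poly R})`_i) -[in LHS](coefK s) coef_poly.
rewrite (eq_bigr (fun j : 'I__ => skew_coef s j * (i == j)%:R)) => [|j _].
  case: ltnP => [i_lt|i_ge].
    rewrite (bigD1 (Ordinal i_lt)) //= eqxx mulr1 big1 ?addr0 // => j ne_ji.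
    by rewrite eq_sym -val_eqE /= in ne_ji; rewrite (negPf ne_ji) mulr0.
  rewrite big1 // => j _; rewrite gtn_eqF ?mulr0 //.
  exact: leq_trans (ltn_ord j) i_ge.
by rewrite skew_coefCM skewXnE /skew_coef coefXn.
Qed.

End SkewPoly.

(* A right R[x,f]-module is a left module over the converse ring. *)
Notation right_skew_module f := (lmodType (skew_poly f)^c).

Definition ract (R : nzRingType) (f : {rmorphism R -> R})
  (N : right_skew_module f) (g : N) (s : skew_poly f) : N :=
  (s : (skew_poly f)^c) *: g.

Section Restriction.
Variables (R : comNzRingType) (f : {rmorphism R -> R}).
Variable N : right_skew_module f.

Lemma ractA (g : N) (s t : skew_poly f) : ract (ract g s) t = ract g (s * t).
Proof. exact: scalerA. Qed.

Definition restriction : Type := N.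

HB.instance Definition _ := GRing.Zmodule.on restriction.

Definition restriction_scale (a : R) (g : restriction) : restriction :=
  ract (g : N) (skewC f a).

Lemma restriction_scaleA a b g :
  restriction_scale a (restriction_scale b g) = restriction_scale (a * b) g.
Proof. by rewrite /restriction_scale ractA -skewCM mulrC. Qed.

Lemma restriction_scale1 : left_id 1 restriction_scale.
Proof. by move=> g; rewrite /restriction_scale skewC1; apply: scale1r. Qed.

Lemma restriction_scaleDr : right_distributive restriction_scale +%R.
Proof. by move=> a g h; apply: scalerDr. Qed.

Lemma restriction_scaleDl g : {morph restriction_scale^~ g : a b / a + b}.
Proof.
by move=> a b; rewrite /restriction_scale skewCD; apply: scalerDl.
Qed.

HB.instance Definition _ := GRing.Zmodule_isLmodule.Build R restriction
  restriction_scaleA restriction_scale1 restriction_scaleDr restriction_scaleDl.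

End Restriction.

Section GradedAnnihilator.
Variables (R : nzRingType) (f : {rmorphism R -> R}).
Local Notation S := (skew_poly f).
Variable N : right_skew_module f.

Definition x_divisible : Prop :=
  forall g : N, exists h : N, g = ract h (skewX f).

Definition gr_ann : set S :=
  [set s | forall (i : nat) (g : N),
    ract g (skewC f (skew_coef s i) * skewX f ^+ i) = 0]%classic.

Definition graded_ideal (I : set S) : Prop :=
  [/\ I 0, (forall s t, I s -> I t -> I (s + t)),
      (forall s t, I t -> I (s * t) /\ I (t * s)) &
      (forall s i, I s -> I (skewC f (skew_coef s i) * skewX f ^+ i))].

Definition annihilates (I : set S) : Prop :=
  forall s, I s -> forall g : N, ract g s = 0.

Lemma skew_coef_mono (a : R) i j :
  skew_coef (skewC f a * skewX f ^+ i) j = a * (j == i)%:R.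
Proof. by rewrite skew_coefCM skewXnE /skew_coef coefXn. Qed.

Lemma skewC0 : skewC f 0 = 0.
Proof. by []. Qed.

Lemma skewC_sum (I : finType) (F : I -> R) :
  skewC f (\sum_i F i) = \sum_i skewC f (F i).
Proof. exact: (big_morph _ (@skewCD _ f) skewC0). Qed.

Lemma skew_compM (s t : S) k :
  skewC f (skew_coef (s * t) k) * skewX f ^+ k =
  \sum_(j < k.+1) (skewC f (skew_coef s j) * skewX f ^+ j) *
                  (skewC f (skew_coef t (k - j)) * skewX f ^+ (k - j)).
Proof.
rewrite skew_coefM skewC_sum mulr_suml; apply: eq_bigr => j _.
by rewrite skew_monoM subnKC // -ltnS.
Qed.

Lemma ract_sum (g : N) (I : finType) (F : I -> S) :
  ract g (\sum_i F i) = \sum_i ract g (F i).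
Proof. exact: (scaler_suml g _ _ (F : I -> S^c)). Qed.

Lemma gr_ann_graded_ideal : graded_ideal gr_ann.
Proof.
split.
- move=> i g; rewrite /skew_coef coef0 skewC0 mul0r; exact: scale0r.
- move=> s t annS annT i g; rewrite skew_coefD skewCD mulrDl.
  rewrite -[LHS]/(_ *: g) (scalerDl g) -[X in X + _]/(ract g _) annS add0r.
  exact: annT.
- move=> s t annT; split=> i g; rewrite skew_compM ract_sum big1 // => j _.
    rewrite -[LHS]/((_ : S^c) *: g) -[RHS](annT (i - j)%N
      (ract g (skewC f (skew_coef s j) * skewX f ^+ j))).
    exact/esym/scalerA.
  transitivity (ract (ract g (skewC f (skew_coef t j) * skewX f ^+ j))
    (skewC f (skew_coef s (i - j)) * skewX f ^+ (i - j))).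
    exact/esym/scalerA.
  by rewrite annT; apply: scaler0.
- move=> s i annS j g; rewrite skew_coef_mono.
  case: eqP => [->|_]; first by rewrite mulr1; apply: annS.
  by rewrite mulr0 skewC0 mul0r; apply: scale0r.
Qed.

Lemma gr_ann_annihilates : annihilates gr_ann.
Proof.
by move=> s annS g; rewrite [s]skew_polyE ract_sum big1 // => i _; apply: annS.
Qed.

Lemma gr_ann_largest (I : set S) :
  graded_ideal I -> annihilates I -> (I `<=` gr_ann)%classic.
Proof. by case=> _ _ _ homI annI s Is i g; apply/annI/homI. Qed.

End GradedAnnihilator.

(* Main.v *)
(* Write [kap v = v x], so that [kap (r^p v) = r * kap v].  Since [M = M x], the
   annihilator of [M / L] is radical and every component of the graded
   annihilator equals it, so it suffices to bound the number of ideals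
   [(L : M)], for [L] a [kap]-stable submodule.  They are radical and closed
   under intersections and colons; by Noetherian induction it is enough to find,
   for each prime [b = (L : M)], an element [c] outside [b] lying in all
   [(L' : M)] for stable [L'] containing [L] with [(L' : M) != b].  Modulo [L],
   up to [b]-torsion and the nilpotent part of [kap] (a submodule [W]), choose
   a basis [e_k] of [M] and a basis [beta_i] of [R] over [R^p].  The Gram matrix
   of [kap (beta_i beta_j e_k)] is then injective modulo [b], so after clearing
   a fixed denominator [u] the coordinates over [R^p] of an element of
   [a = (L' + W : M)] lie in [a] again.  Hence [u^p a] lies in [a^2 + b], and
   Nakayama puts a power of [u], thus [u] itself, in [a]. *)

Require Import Defs.
From HB Require Import structures.
From mathcomp Require Import all_boot all_algebra.
From mathcomp Require Import ring_quotient.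
From mathcomp Require Import boolp classical_sets cardinality.

Set Implicit Arguments.
Unset Strict Implicit.
Unset Printing Implicit Defensive.

Import GRing.Theory.

Local Open Scope ring_scope.
Local Open Scope classical_set_scope.

(** * Submodules as sets, and the Noetherian condition *)

Section Submodules.
Variables (R : comNzRingType) (V : lmodType R).
Implicit Types (W U : set V) (s : seq V) (c : nat -> R).

Definition submodule W :=
  W 0 /\ forall a u v, W u -> W v -> W (a *: u + v).

Lemma submodule0 W : submodule W -> W 0.
Proof. by case. Qed.

Lemma submoduleZ W a v : submodule W -> W v -> W (a *: v).
Proof. by case=> W0 lin Wv; rewrite -[_ *: _]addr0; apply: lin. Qed.

Lemma submoduleD W u v : submodule W -> W u -> W v -> W (u + v).
Proof. by case=> W0 lin Wu Wv; rewrite -[u]scale1r; apply: lin. Qed.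

Lemma submoduleN W v : submodule W -> W v -> W (- v).
Proof. by move=> sW; rewrite -scaleN1r; apply: submoduleZ. Qed.

Lemma submoduleB W u v : submodule W -> W u -> W v -> W (u - v).
Proof. by move=> sW Wu Wv; apply: submoduleD => //; apply: submoduleN. Qed.

Lemma submodule_sum W (I : Type) (r : seq I) (P : pred I) (F : I -> V) :
  submodule W -> (forall i, P i -> W (F i)) -> W (\sum_(i <- r | P i) F i).
Proof.
move=> sW WF; elim/big_rec: _ => [|i v Pi Wv]; first exact: submodule0.
by apply: submoduleD => //; apply: WF.
Qed.

Lemma submoduleP W : submodule W ->
  exists L : submodClosed V, forall v, v \in L <-> W v.
Proof.
move=> [W0 lin]; pose P : {pred V} := fun v => `[< W v >].
have cP : submod_closed P.
  split=> [|a u v /asboolP Wu /asboolP Wv]; apply/asboolP => //.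
  exact: lin.
pose L : submodClosed V := HB.pack P (GRing.isSubmodClosed.Build R V P cP).
by exists L => v; split=> [/asboolP|Wv]; last exact/asboolP.
Qed.

(** Were there no maximal member, dependent choice would iterate strict enlargements into an
    ascending chain that never stabilizes. *)
Lemma noetherian_maximal (F : set (set V)) :
  noetherian V -> (forall W, F W -> submodule W) -> F !=set0 ->
  exists2 W, F W & forall U, F U -> W `<=` U -> U `<=` W.
Proof.
move=> noethV sF [W0 FW0]; apply: contrapT => noMax.
have next (W : {W | F W}) : exists U : {U | F U},
    sval W `<=` sval U /\ ~ sval U `<=` sval W.
  case: W => W FW /=; apply: contrapT => noU; apply: noMax.
  exists W => // U FU WU.
  by apply: contrapT => nUW; apply: noU; exists (exist _ U FU).
have [step stepP] := choice next.
pose w n := iter n step (exist _ W0 FW0).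
have [L LP] := choice (fun n => submoduleP (sF _ (svalP (w n)))).
have [|n /(_ n.+1 (leqnSn n)) LSn] := noethV L.
  by move=> n v /(LP n v) Wv; apply/(LP n.+1 v); apply: (proj1 (stepP (w n))).
apply: (proj2 (stepP (w n))) => v Wv.
by apply/(LP n v)/LSn/(LP n.+1 v).
Qed.

Definition lincomb c s : V := \sum_(i < size s) c i *: s`_i.

Definition shift_coef a c : nat -> R := fun i => if i is j.+1 then c j else a.

Lemma lincomb_cons c v s :
  lincomb c (v :: s) = c 0%N *: v + lincomb (fun i => c i.+1) s.
Proof. by rewrite /lincomb big_ord_recl. Qed.

Lemma lincombD c c' s :
  lincomb c s + lincomb c' s = lincomb (fun i => c i + c' i) s.
Proof. by rewrite -big_split; apply: eq_bigr => i _; rewrite scalerDl. Qed.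

Lemma lincombZ a c s : a *: lincomb c s = lincomb (fun i => a * c i) s.
Proof. by rewrite scaler_sumr; apply: eq_bigr => i _; rewrite scalerA. Qed.

(** Take a maximal finitely generated submodule of [W]: adjoining any [w] in [W] to its generators
    cannot enlarge it. *)
Lemma noetherian_fg W : noetherian V -> submodule W ->
  exists2 s : seq V, forall v, v \in s -> W v &
    forall w, W w -> exists c, w = lincomb c s.
Proof.
move=> noethV sW.
pose F := [set U | exists2 s : seq V, forall v, v \in s -> W v &
  U = [set w | exists c, w = lincomb c s]].
have [||_ [s Ws ->] maxs] := @noetherian_maximal F noethV.
- move=> _ [s _ ->]; split=> [|a _ _ [c ->] [c' ->]].
    by exists (fun=> 0); rewrite /lincomb big1 // => i _; rewrite scale0r.
  by rewrite lincombZ lincombD; eexists.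
- by eexists; exists [::].
exists s => // w Ww; have /= := maxs [set u | exists c, u = lincomb c (w :: s)].
apply.
- by exists (w :: s) => // v; rewrite inE => /predU1P[->|/Ws].
- move=> _ [c ->]; exists (shift_coef 0 c).
  by rewrite lincomb_cons scale0r add0r.
- exists (shift_coef 1 (fun=> 0)).
  rewrite lincomb_cons scale1r /lincomb big1 ?addr0 // => i _.
  by rewrite scale0r.
Qed.

End Submodules.

(** * A finiteness criterion for families of radical ideals *)

Section Ideals.
Variable R : comNzRingType.
Implicit Types (b : set R) (F : set (set R)).

Definition ideal b := @submodule R R^o b.

Lemma ideal_mull b x y : ideal b -> b y -> b (x * y).
Proof. by move=> ib; apply: (@submoduleZ R R^o). Qed.

Lemma ideal_mulr b x y : ideal b -> b x -> b (x * y).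
Proof. by move=> ib bx; rewrite mulrC; apply: ideal_mull. Qed.

Definition prime_ideal b :=
  [/\ ideal b, ~ b 1 & forall x y, b (x * y) -> b x \/ b y].

Lemma prime_idealM b x y : prime_ideal b -> ~ b x -> ~ b y -> ~ b (x * y).
Proof. by case=> _ _ bM nx ny /bM[]. Qed.

Lemma prime_idealX b x n : prime_ideal b -> ~ b x -> ~ b (x ^+ n).
Proof.
move=> pb nx; elim: n => [|n IHn]; first by rewrite expr0; case: pb.
by rewrite exprS; apply: prime_idealM.
Qed.

(* If there is no [x], [y] outside [b] with [x * y] in [b], every radical [a]
   containing [b] is the intersection of [(a : x)], which contains [y],
   and [(a : (a : x))], which contains [x]. *)
Lemma finite_radical_family F :
  noetherian R^o ->
  (forall b, F b -> ideal b) ->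
  (forall b x, F b -> b (x * x) -> b x) ->
  (forall G, G `<=` F -> F [set x | forall b, G b -> b x]) ->
  (forall b y, F b -> F [set x | b (x * y)]) ->
  (forall b, F b -> prime_ideal b ->
     exists2 c, ~ b c & forall a d, F a -> b `<=` a -> a d -> ~ b d -> a c) ->
  finite_set F.
Proof.
move=> noethR iF radF capF colF testF; apply: contrapT => infF.
pose up b := [set a | F a /\ b `<=` a].
(* Choose [b] maximal among the members with infinitely many members above them; as [F] is infinite,
   the intersection of all of [F] is such a member. *)
have [||b [Fb infb] maxb] := @noetherian_maximal R R^o
  [set b | F b /\ ~ finite_set (up b)] noethR.
- by move=> b [/iF].
- exists [set x | forall b, F b -> b x]; split; first exact: capF.
  by apply: contra_not infF; apply: sub_finite_set => a Fa; split=> // x; apply.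
(* The members above [b] that contain [x] have an intersection [bx] in [F] strictly larger than [b],
   so maximality leaves finitely many above [bx]. *)
have fin_above x : ~ b x -> finite_set [set a | up b a /\ a x].
  move=> nbx; set A := [set a | _].
  pose bx := [set z | forall a, A a -> a z].
  have Fbx : F bx by apply: capF => a [[]].
  have bbx : b `<=` bx by move=> z bz a [[_ ba] _]; apply: ba.
  have : finite_set (up bx).
    apply: contrapT => infbx; apply: nbx; apply: (maxb bx) => //.
    by move=> a [].
  apply: sub_finite_set => a Aa; split; first by case: Aa => -[].
  by move=> z; apply.
have [pb|] := pselect (prime_ideal b).
  have [c nbc cP] := testF b Fb pb.
  apply: infb; apply: (@sub_finite_set _ _
    ([set b] `|` [set a | up b a /\ a c])).
    move=> a [Fa ba]; have [ab|] := pselect (a `<=` b).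
      by left; apply/seteqP.
    move=> /existsNP[d /not_implyP[ad nbd]]; right; split=> //.
    exact: (cP a d).
  by rewrite finite_setU; split=> //; apply: fin_above.
have [b1 _|nb1] := pselect (b 1).
  apply: infb; apply: (@sub_finite_set _ _ [set b]) => // a [Fa ba].
  apply/seteqP; split=> // z _; rewrite -[z]mulr1; apply: ideal_mull => //.
  exact: iF.
move=> nprime; have : exists x y, [/\ b (x * y), ~ b x & ~ b y].
  apply: contrapT => nxy; apply: nprime; split=> //; first exact: iF.
  move=> x y bxy; apply: contrapT => /not_orP[nx ny].
  by apply: nxy; exists x, y.
case=> x [y [bxy nbx nby]].
apply: infb; apply: (@sub_finite_set _ _
  [set a1 `&` a2 |
    a1 in [set a | up b a /\ a y] & a2 in [set a | up b a /\ a x]]).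
  move=> a [Fa ba]; have ia := iF a Fa.
  exists [set z | a (z * x)].
    split; last by rewrite /= mulrC; apply: ba.
    by split=> [|z bz]; [apply: colF|apply: ideal_mulr => //; apply: ba].
  exists [set z | forall w, a (w * x) -> a (z * w)].
    split; last by move=> w; rewrite mulrC.
    split=> [|z bz w _]; last by apply: ideal_mulr => //; apply: ba.
    (* The ideal [(a : (a : x))] is the intersection of the [(a : w)] with [w] in [(a : x)], hence a
       member of [F]. *)
    have -> : [set z | forall w, a (w * x) -> a (z * w)] =
        [set z | forall c,
          [set [set z | a (z * w)] | w in [set w | a (w * x)]] c -> c z].
      apply/seteqP; split=> z az.
        by move=> _ [w aw <-]; apply: az.
      by move=> w aw; apply: (az [set z | a (z * w)]); exists w.
    by apply: capF => _ [w _ <-]; apply: colF.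
  apply/seteqP; split=> z.
    by move=> [/= zx /(_ z zx)]; apply: radF.
  by move=> az; split=> [|w _] /=; apply: ideal_mulr.
by apply: finite_image2; apply: fin_above.
Qed.

End Ideals.

(** * Fraction-free linear algebra modulo a prime ideal *)

Section LinearAlgebraModPrime.
Variables (R : comNzRingType) (b : set R).
Hypothesis prime_b : prime_ideal b.

Let ideal_b : ideal b. Proof. by case: prime_b. Qed.

(** Gaussian elimination by cross-multiplication: a pivot outside [b] in the first column reduces to
    the 2 by 2 minors [B]; without a pivot that column vanishes modulo [b]. *)
Lemma dependent_rows n (A : 'I_n.+1 -> 'I_n -> R) :
  exists2 c : 'I_n.+1 -> R, exists i, ~ b (c i) &
    forall j, b (\sum_i c i * A i j).
Proof.
elim: n A => [|n IHn] A.
  exists (fun=> 1); last by case.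
  by exists ord0; case: prime_b.
have [[i0 nbA]|] := pselect (exists i, ~ b (A i ord0)); last first.
  move=> /forallNP/(_ _)/contrapT A0.
  have [c [i nbc] cA] := IHn (fun i j => A (lift ord0 i) (lift ord0 j)).
  exists (fun i => if unlift ord0 i is Some i' then c i' else 0).
    by exists (lift ord0 i); rewrite liftK.
  move=> j; rewrite big_ord_recl unlift_none mul0r add0r.
  under eq_bigr do rewrite liftK.
  case: (unliftP ord0 j) => [j' ->|->]; first exact: cA.
  apply: (@submodule_sum R R^o) => // i' _; apply: ideal_mull => //; exact: A0.
pose B i j := A i0 ord0 * A (lift i0 i) (lift ord0 j)
              - A (lift i0 i) ord0 * A i0 (lift ord0 j).
have [c [i nbc] cB] := IHn B.
exists (fun i => if unlift i0 i is Some i' then A i0 ord0 * c i'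
                 else - \sum_k c k * A (lift i0 k) ord0).
  by exists (lift i0 i); rewrite liftK; apply: prime_idealM.
move=> j; rewrite (bigD1_ord i0) //= unlift_none.
under [X in b (_ + X)]eq_bigr do rewrite liftK.
case: (unliftP ord0 j) => [j' ->|->].
  have -> : - (\sum_k c k * A (lift i0 k) ord0) * A i0 (lift ord0 j') +
    \sum_k A i0 ord0 * c k * A (lift i0 k) (lift ord0 j') = \sum_k c k * B k j'.
    rewrite mulNr mulr_suml addrC -sumrB; apply: eq_bigr => k _.
    by rewrite /B mulrBr !mulrA [c k * A i0 _]mulrC.
  exact: cB.
rewrite mulNr mulrC mulr_sumr addrC -sumrB big1 => [|k _]; last first.
  by rewrite mulrA subrr.
exact: (@submodule0 R R^o).
Qed.

(** Add the indicator row of [y0] to the rows of [G]: the [#|T|.+1] rows are dependent modulo [b],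
    and injectivity forces the coefficient of the new row outside [b]. *)
Lemma injective_mod_prime (T : finType) (G : T -> T -> R) :
  (forall c, (forall y, b (\sum_x c x * G x y)) -> forall x, b (c x)) ->
  exists2 D, ~ b D & forall y0, exists c, forall y,
    b (\sum_x c x * G x y - D * (y == y0)%:R).
Proof.
move=> injG.
have row_y y0 : exists D, ~ b D /\ exists c, forall y,
    b (\sum_x c x * G x y - D * (y == y0)%:R).
  pose A (i : 'I_#|T|.+1) (j : 'I_#|T|) :=
    if unlift ord0 i is Some x then G (enum_val x) (enum_val j)
    else (enum_val j == y0)%:R.
  have [c [i nbc] cA] := dependent_rows A.
  pose c' x := c (lift ord0 (enum_rank x)).
  have {}cA y : b (c ord0 * (y == y0)%:R + \sum_x c' x * G x y).
    have := cA (enum_rank y); rewrite big_ord_recl /A unlift_none enum_rankK.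
    rewrite (reindex (@enum_rank T)) /=; last first.
      by exists enum_val => x _; rewrite ?enum_rankK ?enum_valK.
    under [X in b (_ + X)]eq_bigr do rewrite liftK !enum_rankK.
    by [].
  exists (- c ord0); split; last first.
    by exists c' => y; rewrite mulNr opprK addrC.
  move=> /(@submoduleN R R^o _ _ ideal_b); rewrite opprK => bc0.
  apply: nbc; case: (unliftP ord0 i) => [x ->|-> //].
  rewrite -[x]enum_valK; apply: (injG c' _ (enum_val x)) => y.
  have -> : \sum_x c' x * G x y =
     c ord0 * (y == y0)%:R + \sum_x c' x * G x y - c ord0 * (y == y0)%:R.
    by rewrite addrAC subrr add0r.
  by apply: (@submoduleB R R^o) => //; apply: ideal_mulr.
have [D /all_and2[nbD DP]] := choice row_y.
(* The denominators [D y] depend on the target; their product serves all targets. *)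
exists (\prod_y D y).
  elim/big_rec: _ => [|y x _ nbx]; first by case: prime_b.
  exact: prime_idealM.
move=> y0; have [c cP] := DP y0.
pose D' := \prod_(y | y != y0) D y.
exists (fun x => D' * c x) => y.
have -> : \sum_x D' * c x * G x y - (\prod_y D y) * (y == y0)%:R =
    D' * (\sum_x c x * G x y - D y0 * (y == y0)%:R).
  rewrite [\prod_z _](bigD1 y0) //= -/D' mulrBr mulr_sumr -mulrA mulrCA.
  by congr (_ - _); apply: eq_bigr => x _; rewrite mulrA.
exact: ideal_mull.
Qed.

Section Basis.
Variables (V : lmodType R) (W : set V).
Hypotheses (sW : submodule W) (bW : forall a v, b a -> W (a *: v)).

Definition independent (e : seq V) :=
  forall c : 'I_(size e) -> R, W (\sum_i c i *: e`_i) -> forall i, b (c i).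

(** Greedy choice: if a multiple of [v] by an element outside [b] is a combination of [e] modulo
    [W], only the denominator grows; otherwise [v] joins [e]. *)
Lemma basis_mod_prime (s : seq V) : exists2 e, independent e &
  exists2 t, ~ b t & forall c, exists c', W (t *: lincomb c s - lincomb c' e).
Proof.
elim: s => [|v s [e inde [t nbt tP]]].
  exists [::]; first by move=> c _ [].
  exists 1; first by case: prime_b.
  by move=> c; exists c; rewrite scale1r subrr; apply: submodule0.
have [[t' nbt' [c0 c0P]]|nex] :=
    pselect (exists2 t', ~ b t' & exists c, W (t' *: v - lincomb c e)).
  exists e => //; exists (t * t'); first exact: prime_idealM.
  move=> c; have [c' c'P] := tP (fun i => c i.+1).
  exists (fun i => t * c 0%N * c0 i + t' * c' i).
  have -> : (t * t') *: lincomb c (v :: s)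
      - lincomb (fun i => t * c 0%N * c0 i + t' * c' i) e =
      (t * c 0%N) *: (t' *: v - lincomb c0 e)
      + t' *: (t *: lincomb (fun i => c i.+1) s - lincomb c' e).
    rewrite lincomb_cons -lincombD !scalerBr scalerDr !scalerA [t' * t]mulrC.
    by rewrite !lincombZ opprD addrACA mulrAC.
  by apply: submoduleD => //; apply: submoduleZ.
exists (v :: e); last first.
  exists t => // c; have [c' c'P] := tP (fun i => c i.+1).
  exists (shift_coef (t * c 0%N) c').
  rewrite !lincomb_cons /= scalerDr scalerA opprD addrACA subrr add0r.
  exact: c'P.
move=> c; rewrite big_ord_recl /= => Wc.
have bc0 : b (c ord0).
  apply: contrapT => nbc0; apply: nex; exists (c ord0) => //.
  exists (fun i => - c (inord i.+1)); suff -> :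
    - lincomb (fun i => - c (inord i.+1)) e =
      \sum_(i < size e) c (lift ord0 i) *: e`_i by [].
  rewrite -sumrN; apply: eq_bigr => i _; rewrite scaleNr opprK.
  by congr (c _ *: _); apply: val_inj; rewrite /= inordK // ltnS.
move=> i; case: (unliftP ord0 i) => [j ->|-> //].
apply: (inde (fun j => c (lift ord0 j))).
rewrite -[X in W X](addKr (c ord0 *: v)) addrC; apply: submoduleB => //.
exact: bW.
Qed.

End Basis.

End LinearAlgebraModPrime.

(** * The determinant form of Nakayama's lemma *)

Section Nakayama.
Variables (R : comNzRingType) (a b : set R).
Hypotheses (ideal_a : ideal a) (ideal_b : ideal b).

Lemma det_congr k (A B : 'M[R]_k) :
  (forall i j, a (A i j - B i j)) -> a (\det A - \det B).
Proof.
move=> AB; rewrite /determinant -sumrB.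
apply: (@submodule_sum R R^o) => // s _; rewrite -mulrBr.
apply: ideal_mull => //; apply: (big_ind2 (fun x y => a (x - y))) => //.
  by rewrite subrr; apply: (@submodule0 R R^o).
move=> x1 x2 y1 y2 ax ay.
have -> : x1 * y1 - x2 * y2 = x1 * (y1 - y2) + (x1 - x2) * y2.
  by rewrite mulrBr mulrBl addrA subrK.
by apply: (@submoduleD R R^o) => //; [apply: ideal_mull|apply: ideal_mulr].
Qed.

(** The matrix [B] sends the column [G] into [b]; by its adjugate, [\det B] does so to each [g i].
    Modulo [a], [B] is scalar. *)
Lemma nakayama k (g : 'I_k -> R) (h : 'I_k -> 'I_k -> R) (u : R) :
  (forall i j, a (h i j)) -> (forall i, b (u * g i - \sum_j h i j * g j)) ->
  exists2 d, a (d - u ^+ k) & forall i, b (d * g i).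
Proof.
move=> ah bg; pose B : 'M[R]_k := u%:M - \matrix_(i, j) h i j.
pose G : 'cV[R]_k := \col_i g i.
exists (\det B).
  rewrite -det_scalar; apply: det_congr => i j.
  by rewrite !mxE addrAC subrr add0r; apply: (@submoduleN R R^o).
have BG j : b ((B *m G) j 0).
  rewrite mulmxBl mul_scalar_mx !mxE.
  by under eq_bigr do rewrite !mxE; apply: bg.
move=> i; have -> : \det B * g i = (\adj B *m (B *m G)) i 0.
  by rewrite mulmxA mul_adj_mx mul_scalar_mx !mxE.
by rewrite mxE; apply: (@submodule_sum R R^o) => // j _; apply: ideal_mull.
Qed.

End Nakayama.

(** * Restriction of scalars of [R] along [f] *)

Definition pushforward_module (R : comNzRingType) (f : {rmorphism R -> R})
  : Type := R.

Section Pushforward.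
Variables (R : comNzRingType) (f : {rmorphism R -> R}).
Local Notation pushforward := (pushforward_module f).

HB.instance Definition _ := GRing.Zmodule.on pushforward.

Definition pushforward_scale (a : R) (x : pushforward) : pushforward :=
  f a * (x : R).

Lemma pushforward_scaleA a b x :
  pushforward_scale a (pushforward_scale b x) = pushforward_scale (a * b) x.
Proof. by rewrite /pushforward_scale mulrA rmorphM. Qed.

Lemma pushforward_scale1 : left_id 1 pushforward_scale.
Proof. by move=> x; rewrite /pushforward_scale rmorph1 mul1r. Qed.

Lemma pushforward_scaleDr : right_distributive pushforward_scale +%R.
Proof. by move=> a x y; apply: mulrDr. Qed.

Lemma pushforward_scaleDl x : {morph pushforward_scale^~ x : a b / a + b}.
Proof. by move=> a b; rewrite /pushforward_scale rmorphD mulrDl. Qed.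

HB.instance Definition _ := GRing.Zmodule_isLmodule.Build R pushforward
  pushforward_scaleA pushforward_scale1 pushforward_scaleDr
  pushforward_scaleDl.

End Pushforward.

(** * Colon ideals of submodules stable under a surjective Cartier operator *)

Section CartierModule.
Variables (R : comNzRingType) (V : lmodType R) (f : {rmorphism R -> R}).
Variables (q : nat) (kap : {additive V -> V}).
Hypothesis q_gt1 : (1 < q)%N.
Hypothesis fE : forall x, f x = x ^+ q.
Hypothesis kapZ : forall a v, kap (f a *: v) = a *: kap v.
Hypothesis kap_surj : forall v, exists u, v = kap u.
Hypothesis noethV : noetherian V.
Hypothesis noethR : noetherian R^o.
Hypothesis finite_f : finite_rmorphism f.
Implicit Types (L W : set V) (v : V).

Definition stable L := submodule L /\ forall v, L v -> L (kap v).

Definition colon L : set R := [set x | forall v, L (x *: v)].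

Lemma stable_iter L e v : stable L -> L v -> L (iter e kap v).
Proof. by case=> _ kL Lv; elim: e => //= e /kL. Qed.

Lemma colon_ideal L : submodule L -> ideal (colon L).
Proof.
move=> sL; split=> [v|a x y Lx Ly v].
  by rewrite scale0r; apply: submodule0.
rewrite scalerDl -scalerA; apply: submoduleD => //; exact: submoduleZ.
Qed.

Lemma f_mul x : exists y, f x = x * y.
Proof. by exists (x ^+ q.-1); rewrite fE -exprS prednK // ltnW. Qed.

Lemma iter_f_mul e x : exists y, iter e f x = x * y.
Proof.
elim: e => [|e [y ey]]; first by exists 1; rewrite mulr1.
by rewrite iterS; have [z ->] := f_mul (iter e f x); rewrite ey -mulrA; eexists.
Qed.

Lemma iter_kapZ e a v : iter e kap (iter e f a *: v) = a *: iter e kap v.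
Proof. by elim: e v => // e IHe v; rewrite iterSr iterS kapZ IHe -iterSr. Qed.

Lemma iter_kapD e u v : iter e kap (u + v) = iter e kap u + iter e kap v.
Proof. by elim: e => //= e ->; rewrite raddfD. Qed.

Lemma iter_kap_surj e v : exists u, v = iter e kap u.
Proof.
elim: e v => [|e IHe] v; first by exists v.
by have [u ->] := kap_surj v; have [w ->] := IHe u; exists w.
Qed.

Lemma prime_f b x : prime_ideal b -> ~ b x -> ~ b (f x).
Proof. by move=> pb nbx; rewrite fE; apply: prime_idealX. Qed.

(** If [v = kap u], then [x *: v = kap (f x *: u)]; surjectivity of [kap] is thus what makes these
    ideals radical. *)
Lemma colon_f L x : stable L -> colon L (f x) -> colon L x.
Proof.
by move=> [_ kL] Lfx v; have [u ->] := kap_surj v; rewrite -kapZ; apply/kL/Lfx.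
Qed.

Lemma colon_radical L x : stable L -> colon L (x * x) -> colon L x.
Proof.
move=> stL Lxx; apply: colon_f => //.
rewrite fE -(subnK q_gt1) exprD expr2; apply: (@ideal_mull _ (colon L)) => //.
by apply: colon_ideal; case: stL.
Qed.

Lemma colon_radicalX L x n : stable L -> colon L (x ^+ n) -> colon L x.
Proof.
move=> stL Lx; have : colon L (x ^+ (2 ^ n)).
  rewrite -(subnK (ltnW (ltn_expl n (leqnn 2)))) exprD.
  apply: (@ideal_mull _ (colon L)) => //.
  by apply: colon_ideal; case: stL.
elim: n {Lx} => [|n IHn]; first by rewrite expr1.
by rewrite expnS mul2n -addnn exprD => /(colon_radical stL).
Qed.

(** * A common element of the colon ideals strictly above a prime one *)

Section TestElement.
Variable L : set V.
Hypotheses (stL : stable L) (primeL : prime_ideal (colon L)).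

Let b := colon L.
Let ideal_b : ideal b. Proof. by case: primeL. Qed.

(** Quantifying over [r] yields a submodule although [kap] is not linear; [d] accounts for torsion,
    [e] for nilpotency. *)
Definition nilpart (d : R) e : set V :=
  [set v | forall r, L (iter e kap (r *: (d *: v)))].

Lemma nilpart_submodule d e : submodule (nilpart d e).
Proof.
have sL := stL.1; split=> [r|a u v Nu Nv r].
  rewrite !scaler0; apply: stable_iter => //; exact: submodule0.
rewrite !scalerDr iter_kapD; apply: submoduleD => //.
by have := Nu (r * a); rewrite !scalerA mulrAC.
Qed.

(** This makes the family directed, so that a maximal member is the largest. *)
Lemma nilpart_mull d d' e e' : nilpart d e `<=` nilpart (d' * d) (e' + e).
Proof.
move=> v Nv r; rewrite iterD; apply: stable_iter => //.
by have := Nv (r * d'); rewrite !scalerA mulrA.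
Qed.

(* The Cartier module [V / L], up to [b]-torsion, modulo its largest nilpotent
   submodule: the resulting [W] makes the pairing [(r, v) |-> kap (r *: v)]
   nondegenerate. *)
Lemma nondegenerate_hull : exists W d e,
  [/\ stable W, L `<=` W, ~ b d & forall v, W v -> L (iter e kap (d *: v))] /\
  (forall c v, ~ b c -> W (c *: v) -> W v) /\
  (forall v, (forall r, W (kap (r *: v))) -> W v).
Proof.
have [||_ [d nbd [e ->]] maxW] := @noetherian_maximal R V
    [set W | exists2 d, ~ b d & exists e, W = nilpart d e] noethV.
- by move=> _ [d _ [e ->]]; apply: nilpart_submodule.
- by exists (nilpart 1 0), 1; [case: primeL|exists 0%N].
have maxN d' e' : ~ b d' -> nilpart d' e' `<=` nilpart d e.
  move=> nbd'; have sub : nilpart (d * d') (e + e') `<=` nilpart d e.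
    apply: maxW.
      by exists (d * d'); [apply: prime_idealM|exists (e + e')%N].
    by rewrite mulrC addnC; apply: nilpart_mull.
  by apply: subset_trans sub; apply: nilpart_mull.
exists (nilpart d e), d, e; split; [split=> // | split].
- split=> [|v Nv r]; first exact: nilpart_submodule.
  rewrite scalerA -kapZ -iterSr iterS; apply: stL.2.
  rewrite rmorphM; have [y ->] := f_mul d.
  by rewrite mulrA mulrAC -scalerA.
- move=> v Lv r; apply: stable_iter => //.
  by do 2 apply: (submoduleZ _ stL.1).
- by move=> v /(_ 1); rewrite scale1r.
- move=> c v nbc Nv; apply: (maxN (d * c) e); first exact: prime_idealM.
  by move=> r; rewrite -[(d * c) *: v]scalerA; apply: Nv.
(* The extra [kap] raises [e] by one, and [d] is moved inside it as [f d]. *)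
- move=> v Nv; apply: (maxN (f d) e.+1); first exact: prime_f.
  move=> r; rewrite iterSr scalerA mulrC -scalerA kapZ.
  by have := Nv r 1; rewrite scale1r.
Qed.

(** * Coordinates over the image of [f] and the Gram matrix *)

Section Coordinates.
Variable W : set V.
Hypotheses (stW : stable W) (LW : L `<=` W).
Hypothesis torsionfreeW : forall c v, ~ b c -> W (c *: v) -> W v.
Hypothesis nondegW : forall v, (forall r, W (kap (r *: v))) -> W v.

Let sW : submodule W := stW.1.
Let bW a v : b a -> W (a *: v). Proof. by move=> ba; apply/LW/ba. Qed.

(** If [x] is in [colon L'], every [kap (x *: v)] lies in [L']; taking for [v] the vectors dual to
    the basis under the Gram matrix isolates each coordinate of [x]. *)
Lemma colon_coordinates : exists u (s : seq R), ~ b u /\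
  forall L', stable L' -> W `<=` L' -> forall x, colon L' x ->
  exists c : nat -> R, (forall i, (i < size s)%N -> colon L' (c i)) /\
    b (f u * x - \sum_(i < size s) f (c i) * s`_i).
Proof.
have [g _ gP] := @noetherian_fg R V setT noethV (conj I (fun _ _ _ _ _ => I)).
have [e inde [t1 nbt1 t1P]] := basis_mod_prime primeL sW bW g.
have [g' g'P] := finite_f.
pose P := pushforward_module f.
have sb : @submodule R P b.
  split=> [|a x y bx bY]; first exact: (@submodule0 R R^o b).
  by apply: (@submoduleD R R^o b) => //; apply: (@ideal_mull R b).
have [B indB [t2 nbt2 t2P]] :
    exists2 B, @independent R b P b B & exists2 t, ~ b t &
      forall c, exists c', b (t *: lincomb c (g' : seq P) - lincomb c' B).
  apply: basis_mod_prime => // a x ba; apply: (@ideal_mulr R b) => //.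
  by have [y ->] := f_mul a; apply: (@ideal_mulr R b).
have e_span v : exists c, W (t1 *: v - lincomb c e).
  by have [c ->] := gP v I; apply: t1P.
have B_span x : exists c : nat -> R,
    b (f t2 * x - \sum_(i < size B) f (c i) * (B`_i : R)).
  by have [c ->] := g'P x; apply: t2P.
have [C CP] := choice e_span.
pose T : finType := ('I_(size B) * 'I_(size e))%type.
pose beta (i : 'I_(size B)) : R := B`_i.
pose G (x y : T) : R := C (kap ((beta y.1 * beta x.1) *: e`_x.2)) y.2.
(* Each [f (c x)] leaves [kap] as [c x], so the coordinates of [t1 *: kap (beta j *: mm c)] come
   from the row [c] times [G]. *)
pose mm (c : T -> R) : V := \sum_x f (c x) *: (beta x.1 *: e`_x.2).
have mmP c j : W (t1 *: kap (beta j *: mm c)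
                  - \sum_k (\sum_x c x * G x (j, k)) *: e`_k).
  have -> : \sum_k (\sum_x c x * G x (j, k)) *: e`_k =
      \sum_x c x *: lincomb (C (kap ((beta j * beta x.1) *: e`_x.2))) e.
    under eq_bigr do rewrite scaler_suml; rewrite exchange_big /=.
    apply: eq_bigr => x _; rewrite scaler_sumr.
    by apply: eq_bigr => k _; rewrite scalerA.
  have -> : t1 *: kap (beta j *: mm c) =
      \sum_x c x *: (t1 *: kap ((beta j * beta x.1) *: e`_x.2)).
    rewrite !scaler_sumr raddf_sum scaler_sumr; apply: eq_bigr => x _.
    rewrite [beta j *: (f _ *: _)]scalerA [beta j * f _]mulrC.
    rewrite -[(f _ * _) *: _]scalerA kapZ [beta j *: (_ *: _)]scalerA.
    by rewrite [LHS]scalerA mulrC -[LHS]scalerA.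
  rewrite -sumrB; apply: submodule_sum => // x _.
  by rewrite -scalerBr; apply: submoduleZ => //; apply: CP.
have kap_coord v x (c : nat -> R) :
    b (f t2 * x - \sum_(i < size B) f (c i) * (B`_i : R)) ->
    W (t2 *: kap (x *: v) - \sum_(j < size B) c j *: kap (beta j *: v)).
  move=> bx; rewrite -kapZ scalerA.
  have -> : \sum_(j < size B) c j *: kap (beta j *: v) =
      kap ((\sum_(i < size B) f (c i) * beta i) *: v).
    rewrite scaler_suml raddf_sum; apply: eq_bigr => j _.
    by rewrite -scalerA kapZ.
  by rewrite -raddfB -scalerBl; apply/stW.2/bW.
(* A row killed by [G] gives [kap (r *: mm c)] in [W] for all [r], hence [mm c] in [W] by
   nondegeneracy; independence of [e], then of [B], puts [c] in [b]. *)
have injG c : (forall y, b (\sum_x c x * G x y)) -> forall x, b (c x).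
  move=> cG.
  have kmm j : W (kap (beta j *: mm c)).
    apply: (torsionfreeW nbt1).
    rewrite -[X in W X](subrK (\sum_k (\sum_x c x * G x (j, k)) *: e`_k)).
    apply: submoduleD => //; apply: submodule_sum => // k _; exact: bW.
  have Wmm : W (mm c).
    apply: nondegW => r; have [c' /(kap_coord (mm c)) Wr] := B_span r.
    apply: (torsionfreeW nbt2).
    rewrite -[X in W X](subrK (\sum_(j < size B) c' j *: kap (beta j *: mm c))).
    apply: submoduleD => //.
    by apply: submodule_sum => // j _; apply: submoduleZ.
  have mmE : mm c = \sum_k (\sum_i f (c (i, k)) * beta i) *: e`_k.
    under [RHS]eq_bigr do rewrite scaler_suml.
    rewrite exchange_big pair_big /=; apply: eq_bigr => -[i k] _ /=.
    by rewrite scalerA.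
  rewrite mmE in Wmm.
  case=> i k; apply: (indB (fun i => c (i, k))).
  exact: (inde (fun k => \sum_i f (c (i, k)) * beta i)).
have [D nbD DP] := injective_mod_prime primeL injG.
(* Here [D] is the denominator of the inverse Gram matrix, [t1] that of coordinates in [e], and [t2]
   that of coordinates in [B]. *)
exists (D * t1 * t2), B; split.
  by apply: prime_idealM => //; apply: prime_idealM.
move=> L' stL' WL' x L'x; have [c cP] := B_span x.
have sL' := stL'.1.
exists (fun i => D * t1 * c i); split; last first.
  have -> : f (D * t1 * t2) * x - \sum_(i < size B) f (D * t1 * c i) * B`_i =
     f (D * t1) * (f t2 * x - \sum_(i < size B) f (c i) * (B`_i : R)).
    rewrite rmorphM mulrBr mulrA mulr_sumr; congr (_ - _).
    by apply: eq_bigr => i _; rewrite rmorphM mulrA.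
  exact: (@ideal_mull R b).
move=> i ltiB.
(* With [c'] the row of the inverse Gram matrix for [(i, k)], scaled by [D], the sum of the
   [c j *: gram j] collapses to [(D * c i) *: e_k] modulo [W]. *)
have L'e k : L' ((D * c i) *: e`_(k : 'I_(size e))).
  have [c' c'P] := DP (Ordinal ltiB, k).
  have Wx := WL' _ (kap_coord (mm c') x c cP).
  have L'c : L' (\sum_(j < size B) c j *: kap (beta j *: mm c')).
    rewrite -[X in L' X](subKr (t2 *: kap (x *: mm c'))).
    apply: submoduleB => //; apply: submoduleZ => //; exact/stL'.2/L'x.
  have {L'c} := submoduleZ t1 sL' L'c.
  rewrite scaler_sumr => L'c.
  pose gram (j : 'I_(size B)) : V :=
    \sum_k' (\sum_x c' x * G x (j, k')) *: e`_k'.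
  have L'gram : L' (\sum_(j < size B) c j *: gram j).
    rewrite -[X in L' X](subKr
      (\sum_(j < size B) t1 *: (c j *: kap (beta j *: mm c')))).
    apply: submoduleB => //; rewrite -sumrB; apply: submodule_sum => // j _.
    rewrite scalerA mulrC -scalerA -scalerBr; apply: submoduleZ => //.
    exact/WL'/mmP.
  have -> : (D * c i) *: e`_k = \sum_(j < size B) c j *:
      \sum_k' (D * ((j, k') == (Ordinal ltiB, k))%:R) *: e`_k'.
    rewrite (bigD1 (Ordinal ltiB)) //= [X in _ + X]big1 => [|j nej]; last first.
      rewrite big1 ?scaler0 // => k' _; rewrite xpair_eqE (negPf nej) mulr0.
      exact: scale0r.
    rewrite (bigD1 k) //= big1 => [|k' nek]; last first.
      by rewrite xpair_eqE (negPf nek) andbF mulr0 scale0r.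
    by rewrite !addr0 eqxx mulr1 scalerA mulrC.
  rewrite -[X in L' X](subKr (\sum_(j < size B) c j *: gram j)).
  apply: submoduleB => //; rewrite -sumrB; apply: submodule_sum => // j _.
  rewrite -scalerBr -sumrB; apply: submoduleZ => //.
  apply: submodule_sum => // k' _.
  by rewrite -scalerBl; apply/WL'/bW/c'P.
move=> v; have [c' c'P] := e_span v.
rewrite mulrAC -scalerA -[X in L' X](subrK ((D * c i) *: lincomb c' e)).
rewrite -scalerBr.
apply: submoduleD => //; first by apply: submoduleZ => //; apply: WL'.
rewrite scaler_sumr; apply: submodule_sum => // k _.
by rewrite scalerA mulrC -scalerA; apply: submoduleZ.
Qed.

(** The coordinates give that [f u * a] lies in [a^2 + b], so Nakayama yields [c] congruent to a
    power of [f u] modulo [a] with [c * a] inside [b]. As [d] is in [a] but not in [b], [c] is in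
    [b], and the radical ideal [a] contains [u]. *)
Lemma test_element_hull : exists2 u, ~ b u &
  forall L', stable L' -> W `<=` L' ->
  forall d, colon L' d -> ~ b d -> colon L' u.
Proof.
have [u [s [nbu us]]] := colon_coordinates; exists u => //.
move=> L' stL' WL' d ad nbd; set a := colon L' in ad *.
have ideal_a : ideal a by apply: colon_ideal; case: stL'.
have ba : b `<=` a by move=> x bx v; apply/WL'/LW/bx.
have [g ag gP] := @noetherian_fg R R^o a noethR ideal_a.
(* This is [a^2], expressed with coefficients in [a] on fixed generators, the form that Nakayama
   needs. *)
pose aa : set R^o :=
  [set z : R^o | exists2 h, forall m, a (h m) & z = lincomb h g].
have saa : submodule aa.
  split=> [|r _ _ [h ah ->] [h' ah' ->]].
    exists (fun=> 0); first by move=> _; apply: (@submodule0 R R^o a).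
    by rewrite /lincomb big1 // => i _; rewrite scale0r.
  exists (fun i => r * h i + h' i); last by rewrite lincombZ lincombD.
  by move=> m; apply: (ideal_a.2 r (h m) (h' m)); [apply: ah|apply: ah'].
have aaM x y : a x -> a y -> aa (x * y).
  move=> ax /gP[c ->]; exists (fun i => x * c i); last by rewrite -lincombZ.
  by move=> m; apply: (@ideal_mulr R a).
have fu_aa x : a x -> exists2 z, aa z & b (f u * x - z).
  move=> /(us _ stL' WL')[c [ac bc]]; eexists; last exact: bc.
  apply: (submodule_sum (W := aa)) => // i _.
  (* Since [q] is at least 2, [f (c i)] contains the product of two factors [c i] from [a]. *)
  rewrite fE -(subnK q_gt1) exprD expr2 mulrA.
  rewrite -mulrA; apply: aaM; last by apply: (@ideal_mulr R a) => //; apply: ac.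
  by apply: (@ideal_mull R a) => //; apply: ac.
have hex (i : 'I_(size g)) : exists h : nat -> R,
    (forall m, a (h m)) /\ b (f u * g`_i - \sum_(j < size g) h j * g`_j).
  have [|_ [h ah ->] bh] := fu_aa g`_i; last by exists h.
  by apply/ag/mem_nth.
have [h hP] := choice hex.
have [c ac cg] := @nakayama R a b ideal_a ideal_b _ (fun i => g`_i)
  (fun i j => h i j) (f u) (fun i j => (hP i).1 j) (fun i => (hP i).2).
have bcd : b (c * d).
  have [e ->] := gP d ad; rewrite mulr_sumr.
  apply: (@submodule_sum R R^o) => // i _.
  by rewrite mulrCA; apply: (@ideal_mull R b) => //; apply: cg.
have bc : b c by case: primeL => _ _ /(_ c d bcd)[].
apply: (colon_radicalX (n := q * size g)) => //.
rewrite exprM -fE -[X in colon L' X](subKr c).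
by apply: (@submoduleB R R^o a) => //; apply: ba.
Qed.

End Coordinates.

Lemma submodule_add W U : submodule W -> submodule U ->
  submodule [set w + u | w in W & u in U].
Proof.
move=> sW sU; split=> [|a _ _ [w Ww [u Uu <-]] [w' Ww' [u' Uu' <-]]].
  exists 0; first exact: submodule0.
  by exists 0; [exact: submodule0|rewrite addr0].
exists (a *: w + w'); first exact: sW.2.
exists (a *: u + u'); first exact: sU.2.
by rewrite scalerDr addrACA.
Qed.

(** Apply the previous bound to [L' + W], so that [u] maps [V] into it; multiplying by [d] and
    applying [kap] [e] times then sends the [W] part into [L]. *)
Lemma test_element : exists2 c, ~ b c &
  forall L' d, stable L' -> L `<=` L' -> colon L' d -> ~ b d -> colon L' c.
Proof.
have [W [d [e [[stW LW nbd dW] [tfW ndW]]]]] := nondegenerate_hull.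
have [u nbu uP] := test_element_hull stW LW tfW ndW.
exists (d * u); first exact: prime_idealM.
move=> L' d' stL' LL' L'd' nbd'.
pose L'' := [set l + w | l in L' & w in W].
have stL'' : stable L''.
  split; first by apply: submodule_add; [case: stL'|case: stW].
  move=> _ [l L'l [w Ww <-]]; exists (kap l); first exact: stL'.2.
  by exists (kap w); [exact: stW.2|rewrite raddfD].
have L''u : colon L'' u.
  apply: (uP _ stL'' _ d') => // [w Ww|v].
    by exists 0; [apply: submodule0; case: stL'|exists w; rewrite ?add0r].
  exists (d' *: v); first exact: L'd'.
  by exists 0; [apply: submodule0; case: stW|rewrite addr0].
(* Inside the [e]-fold [kap], [d * u] becomes its [e]-th Frobenius iterate, which is still a
   multiple of [d * u]. *)
move=> v; have [v' ->] := iter_kap_surj e v.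
rewrite -iter_kapZ iter_rmorphM.
have [y ->] := iter_f_mul e d; have [z ->] := iter_f_mul e u.
have -> : d * y * (u * z) = d * (u * (y * z)) by rewrite -mulrA [y * _]mulrCA.
have [l L'l [w Ww lw]] := L''u ((y * z) *: v').
rewrite -scalerA -scalerA -lw scalerDr iter_kapD.
apply: submoduleD; first by case: stL'.
  by apply: stable_iter => //; apply: submoduleZ => //; case: stL'.
exact/LL'/dW.
Qed.

End TestElement.

Lemma finite_colons : finite_set [set colon L | L in stable].
Proof.
apply: finite_radical_family => //.
- by move=> _ [L [sL _] <-]; apply: colon_ideal.
- by move=> _ x [L stL <-]; apply: colon_radical.
- move=> F FS.
  (* Intersections of ideals come from intersections of stable submodules. *)
  exists [set v | forall L, stable L -> F (colon L) -> L v].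
    split=> [|v Fv L stL FL]; last by apply: stL.2; apply: Fv.
    split=> [L [sL _] _|a u v Fu Fv L stL FL]; first exact: submodule0.
    by case: (stL) => sL _; apply: sL.2; [apply: Fu|apply: Fv].
  apply/seteqP; split=> x /= Fx.
    move=> c Fc; have [L stL Lc] := FS c Fc.
    by rewrite -Lc in Fc * => v; apply: Fx.
  by move=> v L stL FL; apply: (Fx _ FL).
(* The preimage of [L] under multiplication by [y] is stable because [f y] is a multiple of [y]. *)
- move=> _ y [L stL <-]; exists [set v | L (y *: v)].
    case: stL => sL kL; split=> [|v Lv].
      split=> [|a u v Lu Lv]; first by rewrite /= scaler0; apply: submodule0.
      by rewrite /= scalerDr scalerA mulrC -scalerA; apply: sL.2.
    have [z fy] := f_mul y.
    by rewrite /= -kapZ fy mulrC -scalerA; apply: kL; apply: submoduleZ.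
  apply/seteqP; split=> x /= Lx v; have := Lx v;
    by rewrite /colon /= !scalerA mulrC.
- move=> _ [L0 stL0 <-] pL0.
  (* Unlike [L0], the least stable submodule with the same colon ideal is
     contained in every stable [L'] whose colon ideal is larger. *)
  pose L := [set v | forall L', stable L' -> colon L0 `<=` colon L' -> L' v].
  have stL : stable L.
    split=> [|v Lv L' stL' L0L']; last by apply: stL'.2; apply: Lv.
    split=> [L' [sL' _] _|a u v Lu Lv L' stL' L0L']; first exact: submodule0.
    by apply: stL'.1.2; [apply: Lu|apply: Lv].
  have LE : colon L = colon L0.
    apply/seteqP; split=> x Lx v; first exact: (Lx v L0 stL0).
    by move=> L' stL' /(_ x Lx).
  rewrite -LE in pL0 *; have [c nc cP] := test_element stL pL0.
  exists c => // _ d [L' stL' <-] LL' L'd nd; apply: (cP L' d) => //.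
  by move=> v; apply=> //; rewrite -LE.
Qed.

End CartierModule.

(** * From right skew modules to Cartier operators *)

Section SkewModule.
Variables (R : comNzRingType) (f : {rmorphism R -> R}).
Variable M : right_skew_module f.

Definition right_x (v : restriction M) : restriction M :=
  ract (v : M) (skewX f).

Lemma right_x_is_additive : zmod_morphism right_x.
Proof. by move=> u v; apply: (@scalerBr _ M). Qed.

HB.instance Definition _ :=
  GRing.isZmodMorphism.Build (restriction M) (restriction M) right_x
    right_x_is_additive.

Lemma right_xZ a v : right_x (f a *: v) = a *: right_x v.
Proof. by rewrite /right_x [LHS]ractA -skewXC -ractA. Qed.

Lemma ract_mono a i (v : restriction M) :
  ract (v : M) (skewC f a * skewX f ^+ i) = iter i right_x (a *: v).
Proof.
elim: i => [|i IHi]; first by rewrite mulr1.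
by rewrite exprSr mulrA -ractA IHi.
Qed.

Lemma stable_submodClosed (L : submodClosed M) :
  stable right_x ([set v : restriction M | (v : M) \in L]).
Proof.
split=> [|v Lv]; last exact: rpredZ.
split=> [|a u v Lu Lv]; first exact: rpred0.
by apply: rpredD => //; apply: rpredZ.
Qed.

Lemma ract_quotient (L : submodClosed M) (v : M) s :
  ract (quotient_proj L v) s = quotient_proj L (ract v s).
Proof. exact/esym/quotient_projZ. Qed.

End SkewModule.

Theorem theorem3p5 (R : comNzRingType) (p : nat) (pR : p \in [pchar R])
  (m : idealr R) (Rlocal : local_with m) (Rnoeth : noetherian R^o)
  (Rcomplete : adic_complete m) (RFfinite : F_finite pR)
  (M : right_skew_module (pFrobenius_aut pR))
  (Mdiv : x_divisible M) (Mnoeth : noetherian (restriction M)) :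
  finite_set [set gr_ann (quotient_module L) | L in [set: submodClosed M]].
Proof.
set f := pFrobenius_aut pR in M Mdiv Mnoeth *.
have p_gt1 : (1 < p)%N by apply/prime_gt1/(pcharf_prime pR).
have fE x : f x = x ^+ p by exact: pFrobenius_autE.
have kap_surj (v : restriction M) : exists u, v = right_x u by apply: Mdiv.
pose graded (b : set R) := [set s : skew_poly f | forall i, b (skew_coef s i)].
have := finite_colons p_gt1 fE (@right_xZ _ _ M) kap_surj Mnoeth Rnoeth
  RFfinite.
move=> /(finite_image graded).
apply: sub_finite_set => _ [L _ <-].
have stL := stable_submodClosed L.
pose LR := [set v : restriction M | (v : M) \in L].
exists (colon LR); first by exists LR.
apply/seteqP; split=> s /= sP i.
  move=> g; rewrite -[g]quotient_reprK ract_quotient; apply/eqP.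
  rewrite quotient_proj_eq0 ract_mono; apply: (stable_iter i stL); exact: sP.
move=> v; have [u ->] := iter_kap_surj kap_surj i v.
rewrite -(iter_kapZ (@right_xZ _ _ M)).
have [y ->] := iter_f_mul p_gt1 fE i (skew_coef s i).
rewrite -scalerA -ract_mono /LR /= -quotient_proj_eq0 -ract_quotient.
exact/eqP/sP.
Qed.
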